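(* (Representation Theorem) For each bounded implicative meet semi-lattice $L$, $L$ is isomorphic to $(L_* )^*$; that is, there exists a generalized Esakia space $X$ such that $L$ is isomorphic, as a bounded implicative meet semi-lattice, to $\langle X^*,\cap,\to,X,\emptyset\rangle$, where $U\to V=X-{\downarrow}(U-V)$.
   Context: A meet semi-lattice with top is implicative if for each $a$ the map $a\wedge(-)$ has a right adjoint $a\to(-)$ ($a\wedge c\le b$ iff $c\le a\to b$); bounded means it also has a bottom. A filter is a nonempty upset closed under $\wedge$; a prime filter is a filter $F\ne L$ such that $F_1\cap F_2\subseteq F$ for filters $F_1,F_2$ implies $F_1\subseteq F$ or $F_2\subseteq F$; $L_+$ is the set of prime filters; $\sigma(a)=\{y\in L_+:a\in y\}$; $D(L)$ is the lattice of finite unions of sets $\sigma(a)$; a filter $G$ is optimal if $G=\sigma^{-1}(P)$ for a prime filter $P$ of $D(L)$; $L_*$ is the set of optimal filters; $\phi(a)=\{y\in L_*:a\in y\}$; $\tau$ on $L_*$ is generated by the subbasis $\{\phi(a)\}\cup\{L_*-\phi(b)\}$; and $L_*$ also denotes $\langle L_*,\tau,\subseteq,L_+\rangle$. A Priestley space is a compact space with a partial order $\le$ such that if $x\not\le y$ there is a clopen upset containing $x$ and not $y$. For $X=\langle X,\tau,\le,X_0\rangle$ with $\langle X,\tau,\le\rangle$ Priestley and $X_0\subseteq X$, $X^*$ is the set of clopen upsets $U$ with $\mathrm{max}(X-U)\subseteq X_0$, and $\mathcal{I}_x=\{U\in X^*:x\notin U\}$. $X$ is a generalized Priestley space if: $X_0$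 is dense; every $x$ lies below some $y\in X_0$; $x\in X_0$ iff for all $U,V\in\mathcal{I}_x$ there is $W\in\mathcal{I}_x$ with $U\cup V\subseteq W$; and $x\le y$ iff every $U\in X^*$ containing $x$ contains $y$. It is a generalized Esakia space if moreover ${\downarrow}U$ is clopen whenever $U=\bigcup_{i=1}^n(U_i-V_i)$ with $U_i,V_i\in X^*$. *)

(* Defs.v *)
From HB Require Import structures.
From mathcomp Require Import all_boot all_order.
From mathcomp Require Import boolp classical_sets functions topology.

Set Implicit Arguments.
Unset Strict Implicit.
Unset Printing Implicit Defensive.

Import Order.TTheory.
Import SetOrder.Exports.

Local Open Scope classical_set_scope.

Definition implication d (L : meetSemilatticeType d) (imp : L -> L -> L) :=
  forall a b c : L, (Order.meet a c <= b)%O <-> (c <= imp a b)%O.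

Section Filters.
Context d (L : meetSemilatticeType d).

Record msl_filter (F : set L) : Prop := MslFilter {
  msl_filter_neq0 : F !=set0;
  msl_filter_up : forall a b, (a <= b)%O -> F a -> F b;
  msl_filter_meet : forall a b, F a -> F b -> F (Order.meet a b) }.

Record prime_filter (F : set L) : Prop := PrimeFilter {
  prime_filter_filter : msl_filter F;
  prime_filter_neqT : F <> [set: L];
  prime_filter_prime : forall F1 F2, msl_filter F1 -> msl_filter F2 ->
    F1 `&` F2 `<=` F -> F1 `<=` F \/ F2 `<=` F }.

Definition sigma (a : L) : set (set L) := [set y | prime_filter y /\ y a].

Definition finite_unions_sigma : set (set (set L)) :=
  [set U | exists s : seq L, U = \bigcup_(a in [set` s]) sigma a].

Lemma sigmaI a b : sigma a `&` sigma b = sigma (Order.meet a b).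
Proof.
apply/seteqP; split=> y /=.
  move=> [[py ya] [_ yb]]; split=> //.
  by apply: (msl_filter_meet (prime_filter_filter py)).
move=> [py yab]; have up := msl_filter_up (prime_filter_filter py).
by split; split=> //; apply: up yab; [exact: leIl | exact: leIr].
Qed.

Lemma sigma_finite_unions a : finite_unions_sigma (sigma a).
Proof.
exists [:: a]; apply/seteqP; split=> y.
  by move=> ya; exists a => //=; rewrite inE.
by move=> [b /=]; rewrite inE => /eqP ->.
Qed.

Lemma finite_unions_sigmaI : meet_closed (mem finite_unions_sigma).
Proof.
move=> U V; rewrite !inE => -[s ->] [t ->].
exists [seq Order.meet a b | a <- s, b <- t]; apply/seteqP; split=> y.
  move=> [[a /= sa ya] [b /= tb yb]]; exists (Order.meet a b).
    by apply/allpairsP; exists (a, b).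
  by rewrite -sigmaI.
move=> [_ /= /allpairsP[[a b] /= [sa tb ->]]]; rewrite -sigmaI => -[ya yb].
by split; [exists a | exists b].
Qed.

Lemma finite_unions_sigmaU : join_closed (mem finite_unions_sigma).
Proof.
move=> U V; rewrite !inE => -[s ->] [t ->].
exists (s ++ t); apply/seteqP; split=> y.
  by move=> [[a /= sa ya]|[a /= ta ya]]; exists a => //=;
    rewrite mem_cat ?sa ?ta ?orbT.
move=> [a /=]; rewrite mem_cat => /orP[sa|ta] ya; first by left; exists a.
by right; exists a.
Qed.

HB.instance Definition _ :=
  Order.isLatticeClosed.Build _ _ (mem finite_unions_sigma)
    finite_unions_sigmaI finite_unions_sigmaU.

(* D(L), with the order and lattice operations inherited from the power set *)
Record DL := MkDL {
  DL_val : set (set L);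
  DL_mem : DL_val \in mem finite_unions_sigma }.

HB.instance Definition _ := [isSub for DL_val].
HB.instance Definition _ := [Choice of DL by <:].
HB.instance Definition _ :=
  [SubChoice_isSubLattice of DL by <: with set_display].

Lemma DL_leE (U V : DL) : (U <= V)%O <-> DL_val U `<=` DL_val V.
Proof. by rewrite -Order.le_val subsetEset. Qed.

Lemma DL_meetE (U V : DL) : DL_val (Order.meet U V) = DL_val U `&` DL_val V.
Proof. by []. Qed.

Lemma DL_joinE (U V : DL) : DL_val (Order.join U V) = DL_val U `|` DL_val V.
Proof. by []. Qed.

Definition sigmaD (a : L) : DL :=
  MkDL (mem_set (sigma_finite_unions a)).

End Filters.

Section Optimal.
Context d (L : meetSemilatticeType d).

Definition optimal : set (set L) :=
  [set G | exists2 P : set (DL L), prime_filter P & G = @sigmaD d L @^-1` P].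

(* L_+ is included in L_* *)
Lemma prime_filter_optimal (F : set L) : prime_filter F -> optimal F.
Proof.
move=> pF; exists [set U : DL L | DL_val U F].
  have upP (U V : DL L) : (U <= V)%O -> DL_val U F -> DL_val V F.
    by move=> /DL_leE; apply.
  split; first split.
  - case: (msl_filter_neq0 (prime_filter_filter pF)) => a Fa.
    by exists (sigmaD a).
  - exact: upP.
  - by move=> U V.
  - move=> PT; have [a nFa] : exists a, ~ F a.
      apply: contrapT => /forallNP nF; apply: (prime_filter_neqT pF).
      by apply/seteqP; split=> // a _; exact: contrapT (nF a).
    by have [] : [set U : DL L | DL_val U F] (sigmaD a) by rewrite PT.
  - move=> F1 F2 fF1 fF2 sP; apply: contrapT => /not_orP[].
    move=> /existsNP[U /not_implyP[F1U nUF]] /existsNP[V /not_implyP[F2V nVF]].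
    have /sP : (F1 `&` F2) (Order.join U V).
      split; [apply: (msl_filter_up fF1) F1U; exact: leUl|].
      by apply: (msl_filter_up fF2) F2V; exact: leUr.
    by case.
by apply/seteqP; split=> a //= -[].
Qed.

Record Lstar := MkLstar {
  Lstar_val : set L;
  Lstar_optimal : Lstar_val \in optimal }.

HB.instance Definition _ := [isSub for Lstar_val].
HB.instance Definition _ := [Choice of Lstar by <:].

Definition phi (a : L) : set Lstar := [set y | Lstar_val y a].

Definition phi_subbase : set (set Lstar) :=
  range phi `|` range (fun b => ~` phi b).

HB.instance Definition _ := isSubBaseTopological.Build Lstar phi_subbase id.

End Optimal.

(* Quadruples <X, tau, <=, X_0> *)
Record ordered_space := OrderedSpace {
  carrier :> topologicalType;
  space_le : carrier -> carrier -> Prop;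
  space_pts : set carrier }.

Section Spaces.
Variable X : ordered_space.
Implicit Types (x y : X) (A U V W : set X).

Definition space_po : Prop :=
  [/\ forall x, space_le x x,
      forall x y, space_le x y -> space_le y x -> x = y &
      forall x y z : X, space_le x y -> space_le y z -> space_le x z].

Definition upset U := forall x y, space_le x y -> U x -> U y.

Definition down A : set X := [set x | exists2 y, A y & space_le x y].

Definition maxpts A : set X :=
  [set x | A x /\ forall y, A y -> space_le x y -> y = x].

Definition priestley : Prop :=
  [/\ compact [set: X], space_po &
      forall x y, ~ space_le x y ->
        exists U, [/\ clopen U, upset U, U x & ~ U y]].

(* X^* *)
Definition star : set (set X) :=
  [set U | [/\ clopen U, upset U & maxpts (~` U) `<=` @space_pts X]].

(* I_x *)
Definition star_avoid x : set (set X) := [set U | star U /\ ~ U x].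

Record generalized_priestley : Prop := GeneralizedPriestley {
  gp_priestley : priestley;
  gp_dense : dense (@space_pts X);
  gp_below : forall x, exists2 y, space_pts y & space_le x y;
  gp_pts : forall x, space_pts x <->
    (forall U V, star_avoid x U -> star_avoid x V ->
       exists2 W, star_avoid x W & U `|` V `<=` W);
  gp_le : forall x y, space_le x y <-> (forall U, star U -> U x -> U y) }.

Record generalized_esakia : Prop := GeneralizedEsakia {
  ge_priestley : generalized_priestley;
  ge_down : forall n (U V : 'I_n -> set X),
    (forall i, star (U i)) -> (forall i, star (V i)) ->
    clopen (down (\bigcup_i (U i `\` V i))) }.

Definition star_imp U V : set X := ~` down (U `\` V).

(* f is an isomorphism of bounded implicative meet semi-lattices from L onto
   <X^*, cap, ->, X, empty>; closure of X^* under these operations is a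
   consequence, f being onto X^*. *)
Record star_iso d (L : tbMeetSemilatticeType d) (imp : L -> L -> L)
    (f : L -> set X) : Prop := StarIso {
  star_iso_bij : set_bij [set: L] star f;
  star_iso_meet : forall a b, f (Order.meet a b) = f a `&` f b;
  star_iso_imp : forall a b, f (imp a b) = star_imp (f a) (f b);
  star_iso_top : f \top%O = [set: X];
  star_iso_bottom : f \bot%O = set0 }.

Definition star_isomorphic d (L : tbMeetSemilatticeType d)
    (imp : L -> L -> L) : Prop :=
  exists f : L -> set X, star_iso imp f.

End Spaces.

(* <L_*, tau, inclusion, L_+> *)
Definition Lstar_space d (L : meetSemilatticeType d) : ordered_space :=
  @OrderedSpace (Lstar L) (fun x y => Lstar_val x `<=` Lstar_val y)
    [set x | prime_filter (Lstar_val x)].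

(* Main.v *)
(* An optimal filter is a nonempty meet-closed set [G] such that whenever
   [sigma a] is covered by [sigma b_1, ..., sigma b_n] and [a] is in [G], some
   [b_i] is in [G].  This first-order description passes to ultrafilter limits,
   which gives compactness of [L_*], and to unions of chains.  Implication makes
   every filter maximal among those avoiding a given [c] prime, so prime filters
   separate filters from points; hence [phi] is an order embedding and
   [down (phi a - phi b)] is the complement of [phi (a -> b)].
   For [U] in [X^*], compactness writes [U] as a finite union of sets [phi a_i];
   a point outside [U] lies below a maximal one, which is a prime filter missing
   all the [a_i], hence missing some common upper bound of them.  So [U] is the
   intersection of the [phi c] containing it, and by compactness it is one of
   them. *)
Require Import Defs.
From HB Require Import structures.
From mathcomp Require Import all_boot all_order.
From mathcomp Require Import boolp classical_sets functions topology.
From mathcomp Require Import cardinality finmap.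

Set Implicit Arguments.
Unset Strict Implicit.
Unset Printing Implicit Defensive.

Import Order.TTheory.

Local Open Scope classical_set_scope.

(** * Zorn's lemma and compactness *)

Lemma Zorn_above (T : Type) (Q : set (set T)) (A0 : set T) : Q A0 ->
  (forall F : set (set T), F !=set0 -> F `<=` Q -> total_on F subset ->
     Q (\bigcup_(A in F) A)) ->
  exists M, [/\ Q M, A0 `<=` M & forall B, Q B -> M `<=` B -> B = M].
Proof.
(* Asking for [Q] of the union with [A0] covers the empty chain, to which [Qch] does not apply. *)
move=> Q0 Qch; have [|A [QA maxA]] := @Zorn_bigcup T [set A | Q (A `|` A0)].
  move=> F FQ Ftot /=; have [->|F0] := eqVneq F set0.
    by rewrite bigcup_set0 set0U.
  have {}F0 : F !=set0 by apply/set0P.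
  rewrite (_ : _ `|` _ = \bigcup_(B in (fun A => A `|` A0) @` F) B).
    apply: Qch.
    - by case: F0 => A FA; exists (A `|` A0); exists A.
    - by move=> _ [A FA <-]; exact: FQ.
    - move=> _ _ [A FA <-] [B FB <-].
      by case: (Ftot _ _ FA FB) => AB; [left|right]; exact: setSU.
  apply/seteqP; split=> x.
    case=> [[A FA Ax]|A0x]; first by exists (A `|` A0); [exists A|left].
    by case: F0 => A FA; exists (A `|` A0); [exists A|right].
  by case=> _ [A FA <-] [Ax|A0x]; [left; exists A|right].
exists (A `|` A0); split=> // B QB sB.
apply: contrapT => neq; apply: (maxA B); last first.
  by rewrite /= setUidl // => x A0x; apply: sB; right.
split; last by move=> BA; apply: neq; apply/seteqP; split=> // x /BA; left.
by move=> x Ax; apply: sB; left.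
Qed.

(** The [K i] form a base of a proper filter; a cluster point of it lies in each closed [K i]. *)
Lemma compact_directed_closed (X : topologicalType) (I : Type) (D : set I)
    (K : I -> set X) : compact [set: X] -> D !=set0 ->
  (forall i j, D i -> D j -> exists2 k, D k & K k `<=` K i `&` K j) ->
  (forall i, D i -> closed (K i)) -> (forall i, D i -> K i !=set0) ->
  \bigcap_(i in D) K i !=set0.
Proof.
move=> cX D0 Kdir Kcl K0.
have fK : ProperFilter (filter_from D K).
  by apply: filter_from_proper => //; apply: filter_from_filter.
have [|x [_ xK]] := cX _ fK; first exact: filterT.
exists x => i Di; apply: (Kcl _ Di) => B xB.
by apply: xK xB; exists i.
Qed.

Lemma down_bigcup (Y : ordered_space) (I : Type) (A : I -> set Y) :
  Defs.down (\bigcup_i A i) = \bigcup_i Defs.down (A i).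
Proof.
apply/seteqP; split=> x; first by move=> [y [i _ Ay] xy]; exists i => //; exists y.
by move=> [i _ [y Ay xy]]; exists y => //; exists i.
Qed.

(** * Filters of a meet semi-lattice *)

Section Semilattice.
Context d (L : meetSemilatticeType d).
Implicit Types (a b c : L) (F G y : set L).

Lemma filter_bigcup_chain (C : set (set L)) : C !=set0 ->
  (forall F, C F -> msl_filter F) -> total_on C subset ->
  msl_filter (\bigcup_(F in C) F).
Proof.
move=> [F0 CF0] fC Ctot; split.
- by have [[a F0a] _ _] := fC _ CF0; exists a, F0.
- by move=> a b ab [F CF Fa]; exists F => //; apply: (msl_filter_up (fC _ CF)) Fa.
- move=> a b [F CF Fa] [G CG Gb].
  by case: (Ctot _ _ CF CG) => s; [exists G|exists F] => //;
    apply: msl_filter_meet; (try exact: fC); (try exact: s).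
Qed.

Lemma principal_filter_msl a : msl_filter [set b | (a <= b)%O].
Proof.
split; first by exists a => /=.
  by move=> b c bc /= ab; exact: le_trans bc.
by move=> b c /= ab ac; rewrite lexI ab ac.
Qed.

(** The common upper bounds of [a] and [b] form the intersection of two principal filters; were they
    all in [y], primality would put [a] or [b] in [y]. *)
Lemma prime_filter_ub y (s : seq L) : prime_filter y ->
  (forall a, a \in s -> ~ y a) ->
  exists2 c, (forall a, a \in s -> (a <= c)%O) & ~ y c.
Proof.
move=> py; elim: s => [|a s IH] ns.
  apply: contrapT => nc; apply: (prime_filter_neqT py).
  by apply/seteqP; split=> // c _; apply: contrapT => nyc; apply: nc; exists c.
have [b bs|b bs nyb] := IH; first by apply: ns; rewrite inE bs orbT.
apply: contrapT => nc.
have [c [/= ac bc]|sub|sub] := prime_filter_prime py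
    (principal_filter_msl a) (principal_filter_msl b).
- apply: contrapT => nyc; apply: nc; exists c => // e.
  by rewrite inE => /orP[/eqP->//|/bs eb]; exact: le_trans bc.
- by apply: (ns a (mem_head _ _)); apply: sub => /=.
- by apply: nyb; apply: sub => /=.
Qed.

Definition filter_add F a := [set c | exists2 g, F g & (Order.meet g a <= c)%O].

Lemma filter_add_msl F a : msl_filter F -> msl_filter (filter_add F a).
Proof.
case=> [[g Fg] Fup Fmeet]; split; first by exists (Order.meet g a), g.
  by move=> b c bc [h Fh hb]; exists h => //; exact: le_trans bc.
move=> b c [h Fh hb] [k Fk kc]; exists (Order.meet h k); first exact: Fmeet.
rewrite lexI (le_trans _ hb) ?(le_trans _ kc) //; apply: leI2 => //.
  exact: leIr.
exact: leIl.
Qed.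

Lemma filter_add_sub F a : F `<=` filter_add F a.
Proof. by move=> g Fg; exists g => //; exact: leIl. Qed.

Lemma filter_add_in F a : F !=set0 -> filter_add F a a.
Proof. by case=> g Fg; exists g => //; exact: leIr. Qed.

End Semilattice.

(** * Prime filters of a lattice *)

Lemma elementary_prime_filter d (D : latticeType d) (P : set D) :
  msl_filter P -> P <> [set: D] ->
  (forall U V, P (Order.join U V) -> P U \/ P V) -> prime_filter P.
Proof.
move=> fP PT Pj; split=> // F1 F2 fF1 fF2 sP.
apply: contrapT => /not_orP[].
move=> /existsNP[U /not_implyP[F1U nU]] /existsNP[V /not_implyP[F2V nV]].
have /sP/Pj[]// : (F1 `&` F2) (Order.join U V).
split; first exact: (msl_filter_up fF1 (leUl _ _) F1U).
exact: (msl_filter_up fF2 (leUr _ _) F2V).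
Qed.

Lemma prime_filter_join d (D : latticeType d) (P : set D) U V :
  prime_filter P -> P (Order.join U V) -> P U \/ P V.
Proof.
move=> [fP _ Pp] PUV.
have [|s|s] := Pp _ _ (principal_filter_msl U) (principal_filter_msl V).
- by move=> W [/= UW VW]; apply: (msl_filter_up fP) PUV; rewrite leUx UW VW.
- by left; apply: s => /=.
- by right; apply: s => /=.
Qed.

(** * Optimal filters and the topology of [Lstar] *)

Section Optimal.
Context d (L : meetSemilatticeType d).
Implicit Types (a b c : L) (s : seq L) (G : set L) (P : set (DL L)).

Lemma DL_sigma (U : DL L) :
  exists s, DL_val U = \bigcup_(b in [set` s]) sigma b.
Proof. by have /set_mem := DL_mem U. Qed.


(** The order of [DL] between [sigmaD a] and a finite join; for empty [s], no prime filter contains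
    [a]. *)
Definition sigma_cover a s :=
  sigma a `<=` \bigcup_(b in [set` s]) sigma b.

(** Primality splits off one [sigmaD b] at a time; an exhausted list would make [U] the least
    element and [P] improper. *)
Lemma prime_filter_sigma P (U : DL L) s : prime_filter P -> P U ->
  DL_val U `<=` \bigcup_(b in [set` s]) sigma b ->
  exists2 b, b \in s & P (sigmaD b).
Proof.
move=> pP; have fP := prime_filter_filter pP.
elim: s U => [|b s IH] U PU sU.
  case: (prime_filter_neqT pP); apply/seteqP; split=> // V _.
  apply: (msl_filter_up fP) PU; apply/DL_leE => y /sU [c].
  by rewrite /= in_nil.
have sD : finite_unions_sigma (\bigcup_(b in [set` s]) sigma b) by exists s.
have : P (Order.join (sigmaD b) (MkDL (mem_set sD))).
  apply: (msl_filter_up fP) PU; apply/DL_leE; rewrite DL_joinE => y /sU [c].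
  rewrite /= inE => /orP[/eqP-> yb|cs yc]; first by left.
  by right; exists c.
move=> /(prime_filter_join pP)[Pb|/IH[//|c cs Pc]].
  by exists b => //; exact: mem_head.
by exists c => //; rewrite inE cs orbT.
Qed.

Lemma optimalP G : optimal G <->
  [/\ G !=set0, forall a b, G a -> G b -> G (Order.meet a b) &
      forall a s, G a -> sigma_cover a s -> exists2 b, b \in s & G b].
Proof.
split=> [[P pP ->]|[G0 Gmeet Gcov]].
  have fP := prime_filter_filter pP; split.
  - case: (msl_filter_neq0 fP) => U PU; have [s Us] := DL_sigma U.
    have [|b _ Pb] := prime_filter_sigma pP PU (s := s); first by rewrite Us.
    by exists b.
  - move=> a b /= Pa Pb; have := msl_filter_meet fP Pa Pb.
    apply: (msl_filter_up fP); apply/DL_leE.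
    by rewrite DL_meetE /= sigmaI.
  - by move=> a s Pa; exact: (prime_filter_sigma pP Pa).
(* The upset generated by the [sigmaD a] with [a] in [G]: [Gcov] makes it proper by the empty list,
   prime by a concatenation, and makes its preimage [G] by a singleton. *)
exists [set U : DL L | exists2 a, G a & sigma a `<=` DL_val U].
  apply: elementary_prime_filter; first split.
  - by case: G0 => a Ga; exists (sigmaD a), a.
  - by move=> U V /DL_leE UV [a Ga aU]; exists a => // y /aU /UV.
  - move=> U V [a Ga aU] [b Gb bV]; exists (Order.meet a b); first exact: Gmeet.
    by rewrite DL_meetE -sigmaI; exact: setISS.
  - have s0 : finite_unions_sigma (\bigcup_(b in [set` [::]]) @sigma _ L b).
      by exists [::].
    move=> /seteqP[_ /(_ (MkDL (mem_set s0)) I) [a Ga]].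
    by move=> /(Gcov _ _ Ga)[b].
  - move=> U V [a Ga]; rewrite DL_joinE.
    have [s Us] := DL_sigma U; have [t Vt] := DL_sigma V => aUV.
    have [|b] := Gcov a (s ++ t) Ga.
      move=> y /aUV; rewrite Us Vt => -[] [b /= bs yb];
      by exists b => //=; rewrite mem_cat bs ?orbT.
    rewrite mem_cat => /orP[bs|bt] Gb; [left|right]; exists b => // y yb.
      by rewrite Us; exists b.
    by rewrite Vt; exists b.
apply/seteqP; split=> b /=; first by move=> Gb; exists b.
move=> [a Ga ab]; have [|c] := Gcov a [:: b] Ga; last by rewrite inE => /eqP->.
by move=> y /ab yb; exists b => //=; rewrite mem_head.
Qed.

Lemma optimal_filter G : optimal G -> msl_filter G.
Proof.
move=> /optimalP[G0 Gmeet Gcov]; split=> // a b ab Ga.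
have [|c] := Gcov a [:: b] Ga; last by rewrite inE => /eqP->.
move=> y [py ya]; exists b => //=; first exact: mem_head.
by split=> //; apply: (msl_filter_up (prime_filter_filter py)) ya.
Qed.

Lemma optimal_bigcup_chain (C : set (set L)) : C !=set0 ->
  C `<=` @optimal _ L -> total_on C subset -> optimal (\bigcup_(G in C) G).
Proof.
move=> C0 Copt Ctot.
have [fn0 _ fmeet] : msl_filter (\bigcup_(G in C) G).
  by apply: filter_bigcup_chain => // G /Copt /optimal_filter.
apply/optimalP; split=> // a s [G CG Ga].
have /optimalP[_ _ Gcov] := Copt _ CG.
by move=> /(Gcov _ _ Ga)[b bs Gb]; exists b => //; exists G.
Qed.

Lemma Lstar_filter (x : Lstar L) : msl_filter (Lstar_val x).
Proof. by apply: optimal_filter; have /set_mem := Lstar_optimal x. Qed.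

Lemma Lstar_cover (x : Lstar L) a s : Lstar_val x a -> sigma_cover a s ->
  exists2 b, b \in s & Lstar_val x b.
Proof.
by have := Lstar_optimal x; move=> /set_mem /optimalP[_ _]; apply.
Qed.

Lemma open_phi_subbase (U : set (Lstar L)) : phi_subbase U -> open U.
Proof.
move=> sU; exists [set U]; last by rewrite bigcup_set1.
move=> _ ->; exists [fset U]%fset; last by rewrite set_fset1 bigcap_set1.
by move=> V /fset1P ->; exact: mem_set.
Qed.

Lemma phi_clopen a : clopen (phi a).
Proof.
split; first by apply: open_phi_subbase; left; exists a.
by rewrite -openC; apply: open_phi_subbase; right; exists a.
Qed.

Lemma nbhs_Lstar_subbase (x : Lstar L) (U : set (Lstar L)) : open U -> U x ->
  exists s : {fset set (Lstar L)}, [/\ {subset s <= @phi_subbase _ L},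
    forall V, V \in s -> V x & \bigcap_(V in [set` s]) V `<=` U].
Proof.
move=> [D sD <-] [V DV Vx]; have [s ss sV] := sD _ DV.
exists s; split=> //.
  by move=> W sW; move: Vx; rewrite -sV; apply.
by rewrite sV => y Vy; exists V.
Qed.

End Optimal.

(** * Separation by prime filters and the embedding [phi] *)

Section Implicative.
Context d (L : tbMeetSemilatticeType d) (imp : L -> L -> L).
Context (himp : implication imp).
Implicit Types (a b c : L) (s : seq L) (F : set L) (x y : Lstar L).
Local Notation X := (Lstar_space L).

(** Let [y] extend [F] and be maximal avoiding [c]. For [a] in [F1] and [b] in [F2] outside [y],
    maximality gives [k] in [y] whose meets with [a] and [b] are below [c]; then [imp k c] is in
    [y], and so is [c]. *)
Lemma prime_filter_separation F c : msl_filter F -> ~ F c ->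
  exists y : set L, [/\ prime_filter y, F `<=` y & ~ y c].
Proof.
move=> fF nFc.
have [|C C0 CQ Ctot|y [[fy nyc] Fy ymax]] :=
    @Zorn_above _ [set G | msl_filter G /\ ~ G c] F.
- by split.
- split; first by apply: filter_bigcup_chain => // G /CQ[].
  by move=> [G /CQ[]].
exists y; split=> //; split=> // [yT|F1 F2 fF1 fF2 sy].
  by apply: nyc; rewrite yT.
have addc a : ~ y a -> filter_add y a c.
  move=> nya; apply: contrapT => nc; apply: nya.
  rewrite -(ymax (filter_add y a)); last exact: filter_add_sub.
    by apply: filter_add_in; case: fy.
  by split=> //; exact: filter_add_msl.
apply: contrapT => /not_orP[].
move=> /existsNP[a /not_implyP[F1a /addc[g yg ga]]].
move=> /existsNP[b /not_implyP[F2b /addc[h yh hb]]].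
have [_ yup ymeet] := fy.
pose k := Order.meet g h; have yk : y k by exact: ymeet.
(* both [a] and [b] lie below [imp k c], which is therefore in [F1] and [F2] *)
have ykc : y (imp k c).
  apply: sy; split.
    apply: (msl_filter_up fF1) F1a; apply/himp/(le_trans _ ga).
    by rewrite leI2 // leIl.
  apply: (msl_filter_up fF2) F2b; apply/himp/(le_trans _ hb).
  by rewrite leI2 // leIr.
by apply: nyc; apply: (yup (Order.meet k (imp k c))); [exact/himp|exact: ymeet].
Qed.

Lemma Lstar_separation F c : msl_filter F -> ~ F c ->
  exists y, [/\ prime_filter (Lstar_val y), F `<=` Lstar_val y & ~ phi c y].
Proof.
move=> fF /(prime_filter_separation fF)[y [py Fy nyc]].
by exists (MkLstar (mem_set (prime_filter_optimal py))).
Qed.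

Lemma phi_le a b : phi a `<=` phi b <-> (a <= b)%O.
Proof.
split=> [ab|ab x xa]; last exact: (msl_filter_up (Lstar_filter x) ab xa).
apply: contrapT => /(Lstar_separation (principal_filter_msl a))[y [_ ay]].
by apply; apply: ab; apply: ay => /=.
Qed.

Lemma phiI a b : phi (Order.meet a b) = phi a `&` phi b.
Proof.
apply/seteqP; split=> x.
  by move=> xab; split; apply: (msl_filter_up (Lstar_filter x)) xab;
    [exact: leIl|exact: leIr].
by case=> xa xb; exact: (msl_filter_meet (Lstar_filter x) xa xb).
Qed.

Lemma phi_top : phi (\top%O : L) = setT.
Proof.
apply/seteqP; split=> // x _; have [a xa] := msl_filter_neq0 (Lstar_filter x).
exact: (msl_filter_up (Lstar_filter x) (lex1 a) xa).
Qed.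

Lemma phi_bot : phi (\bot%O : L) = set0.
Proof.
apply/seteqP; split=> // x xb.
(* Prime filters are proper, so [sigma] of bottom is covered by the empty list. *)
have [|b] := @Lstar_cover _ _ x \bot%O [::] xb; last by rewrite in_nil.
move=> y [py yb]; case: (prime_filter_neqT py); apply/seteqP; split=> // a _.
exact: (msl_filter_up (prime_filter_filter py) (le0x a) yb).
Qed.

(** If [x] misses [imp a b], the filter generated by [x] and [a] misses [b]; a prime filter
    separating the two is the required point above [x]. *)
Lemma down_phiD a b : Defs.down (X := X) (phi a `\` phi b) = ~` phi (imp a b).
Proof.
apply/seteqP; split=> x.
  move=> [y [ya nyb] xy] xab; apply: nyb; have fy := Lstar_filter y.
  apply: (msl_filter_up fy (a := Order.meet a (imp a b))); first exact/himp.
  by apply: (msl_filter_meet fy ya); apply: xy.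
move=> nx; have fx := Lstar_filter x.
have [|y [_ xy nyb]] := Lstar_separation (filter_add_msl a fx) (c := b).
  move=> [g xg gab]; apply: nx; apply: (msl_filter_up fx _ xg).
  by apply/himp; rewrite meetC.
exists y.
  by split=> //; apply: xy; apply: filter_add_in; exact: msl_filter_neq0.
by move=> c xc; apply: xy; exact: filter_add_sub.
Qed.

(** * Compactness, order and basic neighbourhoods *)

Lemma Lstar_compact : compact [set: Lstar L].
Proof.
rewrite compact_ultra => F UF _.
(* This set is the limit of [F]; it satisfies the covering condition because an ultrafilter
   containing a finite union contains one of its members. *)
have Gopt : optimal [set a | F (phi a)].
  apply/optimalP; split.
  - by exists \top%O; rewrite /= phi_top; exact: filterT.
  - by move=> a b /= Fa Fb; rewrite phiI; exact: filterI.
  - move=> a s /= Fa acov.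
    have : F (\bigcup_(b in [set` s]) phi b).
      apply: filterS Fa => x xa.
      by have [b bs xb] := Lstar_cover xa acov; exists b.
    elim: s {acov} => [|b s IH].
      rewrite (_ : \bigcup_(_ in _) _ = set0).
        by move/filter_ex => -[].
      by apply/seteqP; split=> // y [b]; rewrite /= in_nil.
    move=> Fs; have [Fb|Fnb] := in_ultra_setVsetC (phi b) UF.
      by exists b => //; exact: mem_head.
    have [|c cs Fc] := IH; last by exists c => //; rewrite inE cs orbT.
    apply: filterS (filterI Fs Fnb) => y [[c]].
    rewrite /= inE => /orP[/eqP->//|cs yc _].
    by exists c.
exists (MkLstar (mem_set Gopt)); split=> // A.
rewrite nbhsE => -[U [oU Ux] UA]; apply: filterS UA _.
have [s [ssub sx sU]] := nbhs_Lstar_subbase oU Ux.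
apply: filterS sU _; apply: filter_bigI => V Vs.
have /set_mem[[a _ Va]|[b _ Vb]] := ssub _ Vs; have := sx _ Vs.
  by rewrite -Va.
by rewrite -Vb /= => nb; case: (in_ultra_setVsetC (phi b) UF).
Qed.

Lemma Lstar_priestley : priestley X.
Proof.
split; first exact: Lstar_compact.
  split=> [x a //|x y xy yx|x y z xy yz]; last exact: subset_trans yz.
  by apply: val_inj; apply/seteqP.
move=> x y /existsNP[a /not_implyP[xa nya]].
exists (phi a); split=> //; first exact: phi_clopen.
by move=> u v uv; exact: uv.
Qed.

(** A maximal point outside [phi a] lies below a prime filter avoiding [a], hence equals it. *)
Lemma phi_star a : star (X := X) (phi a).
Proof.
split; first exact: phi_clopen; first by move=> u v uv; exact: uv.
move=> x [nxa xmax].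
have [y [py xy nya]] := Lstar_separation (Lstar_filter x) nxa.
by rewrite /= -(xmax y).
Qed.

(** The sets [phi a] merge into one through meets; their complements stay a list, as joins may not
    exist. *)
Lemma nbhs_phi x (U : set (Lstar L)) : open U -> U x ->
  exists a (t : seq L), [/\ Lstar_val x a,
    forall b, b \in t -> ~ Lstar_val x b &
    forall y, Lstar_val y a -> (forall b, b \in t -> ~ Lstar_val y b) -> U y].
Proof.
move=> oU Ux; have [s [ssub sx sU]] := nbhs_Lstar_subbase oU Ux.
suff [a [t [xa nxt at_]]] : exists a (t : seq L), [/\ Lstar_val x a,
    forall b, b \in t -> ~ Lstar_val x b &
    forall y, Lstar_val y a -> (forall b, b \in t -> ~ Lstar_val y b) ->
      forall V, V \in enum_fset s -> V y].
  by exists a, t; split=> // y ya nyt; apply: sU => V /=; exact: at_.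
have {}ssub V : V \in enum_fset s -> phi_subbase V by move=> /ssub/set_mem.
have {}sx V : V \in enum_fset s -> V x by exact: sx.
elim: (enum_fset s) ssub sx => [|V r IH] ssub sx.
  by exists \top%O, [::]; split=> //; rewrite -[Lstar_val _ _]/(phi _ _) phi_top.
have [W Wr|W Wr|a [t [xa nxt at_]]] := IH.
- by apply: ssub; rewrite inE Wr orbT.
- by apply: sx; rewrite inE Wr orbT.
have := sx _ (mem_head _ _).
have [[b _ <-] xb|[b _ <-] nxb] := ssub _ (mem_head _ _).
  exists (Order.meet a b), t; split=> //.
    exact: (msl_filter_meet (Lstar_filter x)).
  move=> y; rewrite -[Lstar_val _ _]/(phi _ _) phiI => -[ya yb] nyt W.
  by rewrite inE => /orP[/eqP->|]//; exact: at_.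
exists a, (b :: t); split=> // [c|y ya nyt W].
  by rewrite inE => /orP[/eqP->|]//; exact: nxt.
rewrite inE => /orP[/eqP->|]; first exact: nyt (mem_head _ _).
by apply: at_ => // c ct; apply: nyt; rewrite inE ct orbT.
Qed.

(** * Density of prime filters and description of [star] *)

Lemma Lstar_dense : dense (@space_pts X).
Proof.
move=> U [x Ux] oU; have [a [t [xa nxt atU]]] := nbhs_phi oU Ux.
(* Otherwise [t] would cover [a], and optimality would put some [b] of [t] in [x]. *)
have /existsNP[y /not_implyP[[py ya] nyt]] : ~ sigma_cover a t.
  by move=> /(Lstar_cover xa)[b bt xb]; exact: nxt xb.
exists (MkLstar (mem_set (prime_filter_optimal py))); split=> //.
by apply: atU => //= b bt yb; apply: nyt; exists b.
Qed.

(** The closed sets [phi c] minus [U], for [c] in [F], are directed through meets and have empty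
    intersection, so one of them is empty. *)
Lemma phi_compact_filter F (U : set (Lstar L)) : msl_filter F -> open U ->
  (forall x, F `<=` Lstar_val x -> U x) -> exists2 c, F c & phi c `<=` U.
Proof.
move=> fF oU FU; apply: contrapT => nc.
have [a b Fa Fb|c Fc|c Fc|x xF] := @compact_directed_closed (Lstar L) L F
    (fun c => phi c `&` ~` U) Lstar_compact (msl_filter_neq0 fF).
- exists (Order.meet a b); first exact: (msl_filter_meet fF).
  by rewrite phiI => x [[xa xb] nUx].
- apply: closedI; first by have [] := phi_clopen c.
  exact: open_closedC.
- apply: contrapT => /set0P/negP/negPn/eqP c0; apply: nc; exists c => // x xc.
  by apply: contrapT => nUx; have : (phi c `&` ~` U) x by []; rewrite c0.
- have [a Fa] := msl_filter_neq0 fF; have [_] := xF _ Fa; apply.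
  by apply: FU => c Fc; have [] := xF _ Fc.
Qed.

(** Concatenation of lists directs the closed uncovered parts of [U]. *)
Lemma phi_finite_cover (A : set L) (U : set (Lstar L)) : closed U ->
  U `<=` \bigcup_(a in A) phi a ->
  exists2 s : seq L, {subset s <= A} & U `<=` \bigcup_(a in [set` s]) phi a.
Proof.
move=> cU UA; apply: contrapT => ns.
have [|s t sA tA|s sA|s sA|x xs] := @compact_directed_closed (Lstar L) (seq L)
    [set s | {subset s <= A}]
    (fun s => U `&` ~` \bigcup_(a in [set` s]) phi a) Lstar_compact.
- by exists [::].
- exists (s ++ t).
    by move=> a; rewrite mem_cat => /orP[/sA|/tA].
  move=> x [Ux nx]; split; split=> // -[a /= ast xa]; apply: nx; exists a => //=;
  by rewrite mem_cat ast ?orbT.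
- apply: closedI => //; apply: open_closedC; apply: bigcup_open => a _.
  by have [] := phi_clopen a.
- apply: contrapT => /set0P/negP/negPn/eqP s0; apply: ns; exists s => // x Ux.
  apply: contrapT => nx.
  by have : (U `&` ~` \bigcup_(a in [set` s]) phi a) x by []; rewrite s0.
have [|Ux _] := xs [::]; first by [].
have [a Aa xa] := UA _ Ux; have [|_] := xs [:: a].
  by move=> b; rewrite inE => /eqP->; exact: mem_set.
by apply; exists a => //=; exact: mem_head.
Qed.

Lemma star_phi (U : set (Lstar L)) : star (X := X) U -> exists a, U = phi a.
Proof.
move=> [[oU cU] upU maxU].
have Uphi x : U x -> exists2 a, phi a x & phi a `<=` U.
  move=> Ux; apply: (phi_compact_filter (Lstar_filter x) oU) => y xy.
  exact: upU Ux.
have [s sU Us] : exists2 s : seq L, {subset s <= [set a | phi a `<=` U]} &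
    U `<=` \bigcup_(a in [set` s]) phi a.
  by apply: phi_finite_cover => // x /Uphi[a xa aU]; exists a.
pose F := [set c | U `<=` phi c].
have fF : msl_filter F.
  split; first by exists \top%O; rewrite /F /= phi_top.
    by move=> a b /phi_le ab Ua x /Ua /ab.
  by move=> a b Ua Ub; rewrite /F /= phiI => x Ux; split; [exact: Ua|exact: Ub].
(* Such a [c] gives [U = phi c]; it remains to see that every point containing [F] lies in [U]. *)
have [|c Fc cU'] := phi_compact_filter fF oU; last first.
  by exists c; apply/seteqP.
move=> x Fx; apply: contrapT => nUx.
have inU y : U y <-> exists2 a, a \in s & Lstar_val y a.
  split=> [/Us[a]|[a /sU/set_mem aU ya]]; first by exists a.
  exact: aU.
(* Missing all of [s] means lying outside [U], so [m] is a maximal point of the complement of [U]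
   above [x]. *)
have [|C C0 CQ Ctot|m [[mopt ms] xm mmax]] := @Zorn_above _
    [set G | optimal G /\ forall a, a \in s -> ~ G a] (Lstar_val x).
- split; first exact: set_mem (Lstar_optimal x).
  by move=> a sa xa; apply: nUx; apply/inU; exists a.
- split; first by apply: optimal_bigcup_chain => // G /CQ[].
  by move=> a sa [G /CQ[_ /(_ _ sa)]].
pose z := MkLstar (mem_set mopt).
have /maxU/= pm : maxpts (X := X) (~` U) z.
  split; first by move=> /inU[a /ms].
  move=> y nUy zy; apply: val_inj; apply: mmax zy; split.
    exact: set_mem (Lstar_optimal y).
  by move=> a sa ya; apply: nUy; apply/inU; exists a.
(* As [c] bounds [s], [U] lies in [phi c]; so [c] is in [F], in [x] and in [m], a contradiction. *)
have [c cs nmc] := prime_filter_ub pm ms.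
apply: nmc; apply: xm; apply: Fx => y /inU[a sa ya].
exact: (msl_filter_up (Lstar_filter y) (cs _ sa) ya).
Qed.

(** * The generalized Priestley and Esakia axioms, and the isomorphism *)

Lemma star_avoid_phi x a : star_avoid (X := X) x (phi a) <-> ~ Lstar_val x a.
Proof. by split=> [[]//|nxa]; split=> //; exact: phi_star. Qed.

Lemma Lstar_generalized_priestley : generalized_priestley X.
Proof.
split; first exact: Lstar_priestley; first exact: Lstar_dense.
- move=> x; have [|y [py xy _]] := Lstar_separation (c := \bot%O) (Lstar_filter x).
    by move=> xb; have : phi \bot%O x by []; rewrite phi_bot.
  by exists y.
(* Through [phi], directedness says that any two elements outside [x] have a common upper bound
   outside [x]. *)
- move=> x; split=> [px U V|dir].
    move=> [/star_phi[a ->] nxa] [/star_phi[b ->] nxb].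
    have [|c cs nxc] := prime_filter_ub px (s := [:: a; b]).
      by move=> c; rewrite !inE => /orP[]/eqP->.
    exists (phi c); first exact/star_avoid_phi.
    by rewrite subUset; split; apply/phi_le/cs; rewrite !inE eqxx ?orbT.
  split; first exact: Lstar_filter.
    move=> xT; have : phi \bot%O x by rewrite /phi /= xT.
    by rewrite phi_bot.
  move=> F1 F2 fF1 fF2 sx; apply: contrapT => /not_orP[].
  move=> /existsNP[a /not_implyP[F1a nxa]] /existsNP[b /not_implyP[F2b nxb]].
  have [W [/star_phi[c ->] nxc] sub] :=
    dir _ _ (proj2 (star_avoid_phi x a) nxa) (proj2 (star_avoid_phi x b) nxb).
  apply: nxc; apply: sx; split.
    by apply: (msl_filter_up fF1) F1a; apply/phi_le => y ya; apply: sub; left.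
  by apply: (msl_filter_up fF2) F2b; apply/phi_le => y yb; apply: sub; right.
- move=> x y; split=> [xy U /star_phi[a ->]|h a]; first exact: xy.
  exact: (h _ (phi_star a)).
Qed.

Lemma Lstar_generalized_esakia : generalized_esakia X.
Proof.
split; first exact: Lstar_generalized_priestley.
(* Since [down] commutes with unions, one difference suffices, and its down-set is the complement of
   some [phi (imp a b)]. *)
move=> n U V sU sV; rewrite down_bigcup.
have cl i : clopen (Defs.down (U i `\` V i)).
  have [a ->] := star_phi (sU i); have [b ->] := star_phi (sV i).
  by rewrite down_phiD; have [o c] := phi_clopen (imp a b); split;
    [exact: closed_openC|exact: open_closedC].
split; first by apply: bigcup_open => i _; have [] := cl i.
apply: closed_bigcup => [|i _]; first exact: finite_finset.
by have [] := cl i.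
Qed.

Lemma phi_star_iso : star_iso (X := X) imp (@phi _ L).
Proof.
split.
- split=> [a _|a b _ _ ab|U /star_phi[a ->]]; [exact: phi_star| |by exists a].
  by apply/eqP; rewrite eq_le; apply/andP; split; apply/phi_le; rewrite ab.
- exact: phiI.
- by move=> a b; rewrite /star_imp down_phiD setCK.
- exact: phi_top.
- exact: phi_bot.
Qed.

End Implicative.

Theorem theorem7p6 (d : Order.disp_t) (L : tbMeetSemilatticeType d)
    (imp : L -> L -> L) (himp : implication imp) :
  [/\ generalized_esakia (Lstar_space L),
      star_isomorphic (Lstar_space L) imp
    & exists X : ordered_space,
        generalized_esakia X /\ star_isomorphic X imp].
Proof.
have esakia := Lstar_generalized_esakia himp.
have iso : star_isomorphic (Lstar_space L) imp.
  by exists (@phi _ L); exact: phi_star_iso.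
by split=> //; exists (Lstar_space L).
Qed.
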